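(* Let $(x,s)\in\mathcal N_\infty^-(\tfrac12)$, and let $(\alpha^*,\eta^* )$ be an optimal solution of the two-variable optimization problem $$\max\ \alpha\quad\text{s.t.}\quad 0<\alpha<1,\ \ \eta\ge0,\ \ \frac{(w_p)_j(w_q)_j}{\mu}\alpha^2+\alpha\Big(u_j\delta\eta-u_j\ln(u_j)\eta-u_j+\tfrac12\Big)+\Big(u_j-\tfrac12\Big)\ge0\quad\forall j\in\{1,\dots,n\},$$ where $w=w(\eta)$ depends on $\eta$. Then one of the following is true: (1) $\alpha^*=1$; (2) there exists $z^*\ge0$ such that $(z^*,\alpha^* )$ is a solution of the system $g_j(z,\alpha)=0$, $g_i(z,\alpha)=0$ for some pair $i,j\in\{1,\dots,n\}$; (3) $\alpha^*$ is a solution of $\Delta_j(\alpha):=(b_j+\alpha c_j)^2-4a_j\big(d_j(1-\alpha)+e_j\alpha^2\big)=0$ for some $j\in\{1,\dots,n\}$, where $\Delta_j(\alpha)$ is the discriminant of $g_j(z,\alpha)$ with respect to $z$.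
   Context: Let $A\in\mathbb R^{m\times n}$ have rank $m$, $b\in\mathbb R^m$, $c\in\mathbb R^n$, and $\mathcal F_+:=\{(x,s): Ax=b,\ A^\top y+s=c \text{ for some } y\in\mathbb R^m,\ x>0,\ s>0\}$. For $(x,s)\in\mathcal F_+$ put $\mu:=x^\top s/n$, and let $X,S,V$ be the diagonal matrices with diagonals $x,s,v$, where $v:=X^{1/2}S^{1/2}e$ ($e$ the all-ones vector); $D:=X^{1/2}S^{-1/2}$, $u:=Xs/\mu$, $\delta:=\frac1n\sum_j u_j\ln u_j$. Functions of vectors are componentwise. $\mathcal N_\infty^-(\beta):=\{(x,s)\in\mathcal F_+: x_js_j/\mu\ge1-\beta\ \forall j\}$. $P_{AD}$ is the orthogonal projection onto the null space of $AD$. For $\eta\ge0$, $w=w(\eta):=-v+\eta\,[\delta v-V\ln(Vv/\mu)]$, $w_p:=P_{AD}w$, $w_q:=w-w_p$. Further, $t_p:=P_{AD}(\delta v-V\ln(Vv/\mu))$, $t_q:=(\delta v-V\ln(Vv/\mu))-t_p$, $v_p:=P_{AD}(-v)$, $v_q:=-v-v_p$, and for each $j$: $a_j:=\frac{(t_p)_j(t_q)_j}{\mu}$, $b_j:=u_j\delta-u_j\ln(u_j)$, $c_j:=\frac{(v_p)_j(t_q)_j+(v_q)_j(t_p)_j}{\mu}$, $d_j:=u_j-\frac12$, $e_j:=\frac{(v_p)_j(v_q)_j}{\mu}$. With these, the $j$th inequality constraint reads $a_j\eta^2\alpha^2+b_j\eta\alpha+c_j\eta\alpha^2+d_j(1-\alpha)+e_j\alpha^2\ge0$.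 With the new variable $z=\alpha\eta$, $g_j(z,\alpha):=a_jz^2+b_jz+c_jz\alpha+d_j(1-\alpha)+e_j\alpha^2$. (In the symbols $b_j,c_j,e_j$ these are scalars unrelated to the vectors $b,c,e$.)
   Formalization: In (2) the pair i,j is taken with i≠j unless z*=0, in which case i=j is allowed: with i≠j always required the claim fails, since the optimum may lie at η*=0 with only one constraint tight. *)

(* Defs.v *)
From HB Require Import structures.
From mathcomp Require Import all_boot all_order all_algebra.
From mathcomp Require Import all_classical all_reals all_analysis.

Set Implicit Arguments.
Unset Strict Implicit.
Unset Printing Implicit Defensive.

Import Order.TTheory GRing.Theory Num.Theory.

Local Open Scope ring_scope.

(* MathComp represents subspaces by row spaces, so the null space
   {p | M *m p = 0} is the row space of a matrix whose rows are the
   transposes p^T. *)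
Definition null_space (R : fieldType) (m n : nat) (M : 'M[R]_(m, n)) : 'M[R]_n :=
  kermx M^T.

Definition orth_compl (R : fieldType) (n : nat) (U : 'M[R]_n) : 'M[R]_n :=
  kermx U^T.

(* Orthogonal projection of the column vector w onto the null space of M:
   the projection onto that space along its orthogonal complement. *)
Definition proj_null (R : fieldType) (m n : nat) (M : 'M[R]_(m, n))
    (w : 'cV[R]_n) : 'cV[R]_n :=
  (w^T *m proj_mx (null_space M) (orth_compl (null_space M)))^T.

Lemma orth_compl_cap (R : realFieldType) (n : nat) (U : 'M[R]_n) :
  (U :&: orth_compl U = 0)%MS.
Proof.
apply/eqP/rowV0P => x; rewrite sub_capmx => /andP[/submxP[y xy] /sub_kermxP xU].
have /matrixP/(_ 0 0) : x *m x^T = 0 by rewrite [in x^T]xy trmx_mul mulmxA xU mul0mx.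
rewrite !mxE => /eqP; rewrite psumr_eq0 => [/allP h|i _]; last first.
  by rewrite mxE -expr2 sqr_ge0.
apply/rowP => i; rewrite mxE; apply/eqP.
by have := h i; rewrite mem_index_enum mxE mulf_eq0 orbb; apply.
Qed.

Lemma orth_compl_full (R : realFieldType) (n : nat) (U : 'M[R]_n) :
  row_full (U + orth_compl U)%MS.
Proof.
rewrite /row_full mxrank_disjoint_sum ?orth_compl_cap //.
by rewrite mxrank_ker mxrank_tr subnKC ?rank_leq_row.
Qed.

Lemma proj_null_in (R : realFieldType) (m n : nat) (M : 'M[R]_(m, n))
    (w : 'cV[R]_n) : M *m proj_null M w = 0.
Proof.
have /sub_kermxP h := proj_mx_sub (null_space M) (orth_compl (null_space M)) w^T.
by apply: trmx_inj; rewrite trmx_mul trmxK h trmx0.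
Qed.

Lemma proj_null_orth (R : realFieldType) (m n : nat) (M : 'M[R]_(m, n))
    (w p : 'cV[R]_n) : M *m p = 0 -> (w - proj_null M w)^T *m p = 0.
Proof.
move=> Mp0; rewrite linearB /= trmxK.
have /sub_kermxP h := proj_mx_compl_sub
  (submx_full w^T (orth_compl_full (null_space M))).
have /submxP[y py] : (p^T <= null_space M)%MS.
  by apply/sub_kermxP; rewrite -trmx_mul Mp0 trmx0.
by rewrite -[p]trmxK py trmx_mul mulmxA h mul0mx.
Qed.

Definition vdiag (R : realType) (n : nat) (x : 'cV[R]_n) : 'M[R]_n := diag_mx x^T.

Definition vsqrt (R : realType) (n : nat) (x : 'cV[R]_n) : 'cV[R]_n :=
  map_mx Num.sqrt x.

Definition vln (R : realType) (n : nat) (x : 'cV[R]_n) : 'cV[R]_n :=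
  map_mx (@ln R) x.

Definition strictly_feasible (R : realType) (m n : nat) (A : 'M[R]_(m, n))
    (b : 'cV[R]_m) (c x s : 'cV[R]_n) : Prop :=
  [/\ A *m x = b,
      exists y : 'cV[R]_m, A^T *m y + s = c,
      forall j, 0 < x j 0
    & forall j, 0 < s j 0].

Definition mu (R : realType) (n : nat) (x s : 'cV[R]_n) : R :=
  (x^T *m s) 0 0 / n%:R.

Definition N_infty_minus (R : realType) (m n : nat) (A : 'M[R]_(m, n))
    (b : 'cV[R]_m) (c : 'cV[R]_n) (beta : R) (x s : 'cV[R]_n) : Prop :=
  strictly_feasible A b c x s
  /\ forall j, 1 - beta <= x j 0 * s j 0 / mu x s.

Definition v_vec (R : realType) (n : nat) (x s : 'cV[R]_n) : 'cV[R]_n :=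
  vdiag (vsqrt x) *m vdiag (vsqrt s) *m const_mx 1.

Definition D_mx (R : realType) (n : nat) (x s : 'cV[R]_n) : 'M[R]_n :=
  vdiag (vsqrt x) *m invmx (vdiag (vsqrt s)).

Definition u_vec (R : realType) (n : nat) (x s : 'cV[R]_n) : 'cV[R]_n :=
  (mu x s)^-1 *: (vdiag x *m s).

Definition delta (R : realType) (n : nat) (x s : 'cV[R]_n) : R :=
  n%:R^-1 * \sum_(j < n) u_vec x s j 0 * ln (u_vec x s j 0).

Definition P_AD (R : realType) (m n : nat) (A : 'M[R]_(m, n)) (x s : 'cV[R]_n)
    (w : 'cV[R]_n) : 'cV[R]_n :=
  proj_null (A *m D_mx x s) w.

Definition t_vec (R : realType) (n : nat) (x s : 'cV[R]_n) : 'cV[R]_n :=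
  let v := v_vec x s in
  delta x s *: v - vdiag v *m vln ((mu x s)^-1 *: (vdiag v *m v)).

Definition w_vec (R : realType) (n : nat) (x s : 'cV[R]_n) (eta : R) : 'cV[R]_n :=
  - v_vec x s + eta *: t_vec x s.

Definition w_p (R : realType) (m n : nat) (A : 'M[R]_(m, n)) (x s : 'cV[R]_n)
    (eta : R) : 'cV[R]_n :=
  P_AD A x s (w_vec x s eta).

Definition w_q (R : realType) (m n : nat) (A : 'M[R]_(m, n)) (x s : 'cV[R]_n)
    (eta : R) : 'cV[R]_n :=
  w_vec x s eta - w_p A x s eta.

Definition t_p (R : realType) (m n : nat) (A : 'M[R]_(m, n)) (x s : 'cV[R]_n) :
    'cV[R]_n :=
  P_AD A x s (t_vec x s).

Definition t_q (R : realType) (m n : nat) (A : 'M[R]_(m, n)) (x s : 'cV[R]_n) :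
    'cV[R]_n :=
  t_vec x s - t_p A x s.

Definition v_p (R : realType) (m n : nat) (A : 'M[R]_(m, n)) (x s : 'cV[R]_n) :
    'cV[R]_n :=
  P_AD A x s (- v_vec x s).

Definition v_q (R : realType) (m n : nat) (A : 'M[R]_(m, n)) (x s : 'cV[R]_n) :
    'cV[R]_n :=
  - v_vec x s - v_p A x s.

Definition coef_a (R : realType) (m n : nat) (A : 'M[R]_(m, n)) (x s : 'cV[R]_n)
    (j : 'I_n) : R :=
  t_p A x s j 0 * t_q A x s j 0 / mu x s.

Definition coef_b (R : realType) (n : nat) (x s : 'cV[R]_n) (j : 'I_n) : R :=
  u_vec x s j 0 * delta x s - u_vec x s j 0 * ln (u_vec x s j 0).

Definition coef_c (R : realType) (m n : nat) (A : 'M[R]_(m, n)) (x s : 'cV[R]_n)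
    (j : 'I_n) : R :=
  (v_p A x s j 0 * t_q A x s j 0 + v_q A x s j 0 * t_p A x s j 0) / mu x s.

Definition coef_d (R : realType) (n : nat) (x s : 'cV[R]_n) (j : 'I_n) : R :=
  u_vec x s j 0 - 2^-1.

Definition coef_e (R : realType) (m n : nat) (A : 'M[R]_(m, n)) (x s : 'cV[R]_n)
    (j : 'I_n) : R :=
  v_p A x s j 0 * v_q A x s j 0 / mu x s.

Definition g (R : realType) (m n : nat) (A : 'M[R]_(m, n)) (x s : 'cV[R]_n)
    (j : 'I_n) (z alpha : R) : R :=
  coef_a A x s j * z ^+ 2 + coef_b x s j * z + coef_c A x s j * z * alpha
  + coef_d x s j * (1 - alpha) + coef_e A x s j * alpha ^+ 2.

Definition Delta (R : realType) (m n : nat) (A : 'M[R]_(m, n)) (x s : 'cV[R]_n)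
    (j : 'I_n) (alpha : R) : R :=
  (coef_b x s j + alpha * coef_c A x s j) ^+ 2
  - 4 * coef_a A x s j
      * (coef_d x s j * (1 - alpha) + coef_e A x s j * alpha ^+ 2).

Definition step_feasible (R : realType) (m n : nat) (A : 'M[R]_(m, n))
    (x s : 'cV[R]_n) (alpha eta : R) : Prop :=
  [/\ 0 < alpha, alpha < 1, 0 <= eta
    & forall j : 'I_n,
        0 <= w_p A x s eta j 0 * w_q A x s eta j 0 / mu x s * alpha ^+ 2
             + alpha * (u_vec x s j 0 * delta x s * eta
                        - u_vec x s j 0 * ln (u_vec x s j 0) * eta
                        - u_vec x s j 0 + 2^-1)
             + (u_vec x s j 0 - 2^-1)].

Definition step_optimal (R : realType) (m n : nat) (A : 'M[R]_(m, n))
    (x s : 'cV[R]_n) (alpha eta : R) : Prop :=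
  step_feasible A x s alpha eta
  /\ forall alpha' eta', step_feasible A x s alpha' eta' -> alpha' <= alpha.

(* Main.v *)
(** Put [z = alpha * eta], so that feasibility of [(alpha, eta)] reads
    [g_j (z, alpha) >= 0] for all [j]. If all these inequalities are strict,
    [alpha] can be increased with [z] kept fixed. If a single one, [g_j], is
    tight and [z > 0], then
    [(d g_j / d z)^2 = Delta_j + 4 a_j g_j = Delta_j]; when [Delta_j] is
    nonzero, moving [z] slightly along the derivative makes all of them
    strict. *)

Require Import Defs.
From HB Require Import structures.
From mathcomp Require Import all_boot all_order all_algebra.
From mathcomp Require Import all_classical all_reals all_analysis.
From mathcomp Require Import ring lra.
Import Order.TTheory GRing.Theory Num.Theory.
Local Open Scope ring_scope.

Lemma P_AD_linear (R : realType) (m n : nat) (A : 'M[R]_(m, n))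
    (x s : 'cV[R]_n) : linear (P_AD A x s).
Proof.
move=> k v w; rewrite /P_AD /proj_null [(_ + w)^T]linearP mulmxDl.
by rewrite -scalemxAl linearP.
Qed.

Lemma w_pE (R : realType) (m n : nat) (A : 'M[R]_(m, n)) (x s : 'cV[R]_n)
    (eta : R) : w_p A x s eta = v_p A x s + eta *: t_p A x s.
Proof. by rewrite /w_p /w_vec addrC P_AD_linear addrC. Qed.

Lemma w_qE (R : realType) (m n : nat) (A : 'M[R]_(m, n)) (x s : 'cV[R]_n)
    (eta : R) : w_q A x s eta = v_q A x s + eta *: t_q A x s.
Proof.
by rewrite /w_q w_pE /v_q /t_q /w_vec [in RHS]scalerBr opprD addrACA.
Qed.

(** By linearity of the projection, [w_p] and [w_q] are affine in [eta], so their product is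
    quadratic in [eta] with coefficients [coef_a], [coef_c], [coef_e] after division by [mu]. *)
Lemma step_feasibleP (R : realType) (m n : nat) (A : 'M[R]_(m, n))
    (x s : 'cV[R]_n) (alpha eta : R) :
  step_feasible A x s alpha eta <->
  [/\ 0 < alpha, alpha < 1, 0 <= eta
    & forall j, 0 <= g A x s j (alpha * eta) alpha].
Proof.
suff gE j : g A x s j (alpha * eta) alpha =
    w_p A x s eta j 0 * w_q A x s eta j 0 / mu x s * alpha ^+ 2
    + alpha * (u_vec x s j 0 * delta x s * eta
               - u_vec x s j 0 * ln (u_vec x s j 0) * eta
               - u_vec x s j 0 + 2^-1)
    + (u_vec x s j 0 - 2^-1).
  by split=> -[? ? ? gge0]; split=> // j; move: (gge0 j); rewrite gE.
have addZE (y t : 'cV[R]_n) : (y + eta *: t) j 0 = y j 0 + eta * t j 0.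
  by rewrite !mxE.
rewrite w_pE w_qE !addZE /g /coef_a /coef_b /coef_c /coef_d /coef_e; ring.
Qed.

(** If [p i > 0], continuity at 0 suffices; if [p i = 0], factor out [t > 0] and use continuity of
    [q i + r i * t]. Finiteness of [I] gives one neighbourhood for all [i]. *)
Lemma quadratic_gt0_at_right (R : realType) (I : finType) (p q r : I -> R) :
  (forall i, 0 <= p i) -> (forall i, p i = 0 -> 0 < q i) ->
  \forall t \near (0^'+)%classic, forall i, 0 < p i + q i * t + r i * t ^+ 2.
Proof.
move=> p_ge0 q_gt0; apply: filter_forall => i.
have poly_gt0 (f : {poly R}) : 0 < f.[0] -> \forall t \near (0^'+)%classic, 0 < f.[t].
  move=> f0_gt0; apply: (cvgr_gt f.[0]) => //.
  by apply: cvg_within_filter; exact: continuous_horner.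
have [p0|p_neq0] := eqVneq (p i) 0.
  have := poly_gt0 ((q i)%:P + (r i) *: 'X).
  rewrite !hornerE => /(_ (q_gt0 i p0)).
  apply: filterS2 (nbhs_right_gt 0) => t t_gt0 qr_gt0.
  by rewrite !hornerE in qr_gt0; have := mulr_gt0 t_gt0 qr_gt0; rewrite p0; lra.
pose f := (p i)%:P + (q i) *: 'X + (r i) *: 'X^2.
have fE t : f.[t] = p i + q i * t + r i * t ^+ 2.
  by rewrite !hornerD !hornerZ hornerC hornerX hornerXn.
have : 0 < f.[0] by rewrite fE expr0n !mulr0 !addr0 lt0r p_neq0 p_ge0.
by move=> /poly_gt0; apply: filterS => t; rewrite fE.
Qed.

Lemma step_feasible_increase (R : realType) (m n : nat) (A : 'M[R]_(m, n))
    (x s : 'cV[R]_n) (alpha z : R) :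
  0 < alpha -> alpha < 1 -> 0 <= z -> (forall j, 0 < g A x s j z alpha) ->
  exists alpha' eta', alpha < alpha' /\ step_feasible A x s alpha' eta'.
Proof.
move=> alpha_gt0 alpha_lt1 z_ge0 g_gt0.
(* [q j] is the partial derivative of [g_j] in [alpha]; the second-order coefficient is [coef_e], so
   the expansion in [t] below is exact. *)
pose q j := coef_c A x s j * z - coef_d x s j + 2 * coef_e A x s j * alpha.
have near_gt0 := @quadratic_gt0_at_right R _ (fun j => g A x s j z alpha)
  q (coef_e A x s) (fun j => ltW (g_gt0 j)).
have [t [t_gt0 t_lt gt_gt0]] : exists t, [/\ 0 < t, t < 1 - alpha
    & forall j, 0 < g A x s j z alpha + q j * t + coef_e A x s j * t ^+ 2].
  apply: (@filter_ex _ (0^'+)%classic); near=> t; split.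
  - near: t; exact: nbhs_right_gt.
  - by near: t; apply: nbhs_right_lt; rewrite subr_gt0.
  - near: t; apply: near_gt0 => j gj0.
    by have := g_gt0 j; rewrite gj0 ltxx.
have at_gt0 : 0 < alpha + t by rewrite addr_gt0.
(* This choice of [eta'] keeps the product [alpha' * eta'] equal to [z]. *)
exists (alpha + t), (z / (alpha + t)); split; first by rewrite ltrDl.
apply/step_feasibleP; split=> //; first by rewrite addrC -ltrBrDr.
  by rewrite divr_ge0 // ltW.
move=> j; rewrite mulrC divfK ?gt_eqF//.
by have := gt_gt0 j; rewrite /q /g; lra.
Unshelve. all: by end_near.
Qed.

(** The sign of the derivative is unknown, so [z > 0] is needed to leave room on both sides. *)
Lemma g_gt0_perturb (R : realType) (m n : nat) (A : 'M[R]_(m, n))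
    (x s : 'cV[R]_n) (alpha z : R) (j : 'I_n) :
  0 < z -> (forall i, 0 <= g A x s i z alpha) ->
  (forall i, g A x s i z alpha = 0 -> i = j) ->
  g A x s j z alpha = 0 -> Delta A x s j alpha != 0 ->
  exists2 z', 0 <= z' & forall i, 0 < g A x s i z' alpha.
Proof.
move=> z_gt0 g_ge0 tight gj0 Delta_neq0.
(* The partial derivative of [g_i] in [z]. *)
pose dg i :=
  2 * coef_a A x s i * z + coef_b x s i + coef_c A x s i * alpha.
have dg2E : dg j ^+ 2 = Delta A x s j alpha.
  transitivity (Delta A x s j alpha + 4 * coef_a A x s j * g A x s j z alpha).
    by rewrite /dg /Delta /g; ring.
  by rewrite gj0 mulr0 addr0.
have dg_neq0 : dg j != 0 by rewrite -sqrf_eq0 dg2E.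
(* Expansion of [g_i] at [z + dg j * t]: for the only index that can be tight, [i = j], the linear
   coefficient is the square [dg j ^+ 2 > 0]. *)
have near_gt0 := @quadratic_gt0_at_right R _ (fun i => g A x s i z alpha)
  (fun i => dg i * dg j) (fun i => coef_a A x s i * dg j ^+ 2) g_ge0.
have near_z_gt0 : \forall t \near (0^'+)%classic, 0 < z + dg j * t.
  (* A family with a single member, indexed by [unit], with zero quadratic term. *)
  near=> t; suff: unit -> 0 < z + dg j * t + 0 * t ^+ 2.
    by move=> /(_ tt); rewrite mul0r addr0.
  near: t; apply: (@quadratic_gt0_at_right R unit) => [_|_ z0]; first exact: ltW.
  by move: z_gt0; rewrite z0 ltxx.
have [t [zt_gt0 gt_gt0]] : exists t, 0 < z + dg j * t /\
    forall i, 0 < g A x s i z alpha + dg i * dg j * t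
                  + coef_a A x s i * dg j ^+ 2 * t ^+ 2.
  apply: (@filter_ex _ (0^'+)%classic); near=> t; split; near: t.
    exact: near_z_gt0.
  apply: near_gt0 => i /tight ->.
  by rewrite -expr2 exprn_even_gt0.
exists (z + dg j * t); first exact: ltW.
by move=> i; have := gt_gt0 i; rewrite /dg /g; lra.
Unshelve. all: by end_near.
Qed.

(* A system g_j = g_i = 0 involves two different constraints, except that at
   z = 0, where z >= 0 is itself tight, a single constraint may be tight. *)
Theorem proposition5p1 (R : realType) (m n : nat) (A : 'M[R]_(m, n))
    (b : 'cV[R]_m) (c : 'cV[R]_n) (x s : 'cV[R]_n) (alpha_opt eta_opt : R)
    (rankA : \rank A = m)
    (xs_nbhd : N_infty_minus A b c 2^-1 x s)
    (opt : step_optimal A x s alpha_opt eta_opt) :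
  [\/ alpha_opt = 1,
      exists z_opt : R, 0 <= z_opt /\
        exists i j : 'I_n, [/\ i <> j \/ z_opt = 0,
          g A x s j z_opt alpha_opt = 0 & g A x s i z_opt alpha_opt = 0]
    | exists j : 'I_n, Delta A x s j alpha_opt = 0].
Proof.
case: opt => /step_feasibleP[alpha_gt0 alpha_lt1 eta_ge0 g_ge0] alpha_max.
have not_all_gt0 z' : 0 <= z' -> ~ forall i, 0 < g A x s i z' alpha_opt.
  move=> z'_ge0.
  move=> /(@step_feasible_increase _ _ _ _ _ _ _ _ alpha_gt0 alpha_lt1 z'_ge0)[alpha' [eta']].
  by rewrite ltNge => -[/negP + /alpha_max].
have z_ge0 : 0 <= alpha_opt * eta_opt by rewrite mulr_ge0// ltW.
(* From here on [eta_opt] matters only through the product [z]. *)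
move: (alpha_opt * eta_opt) g_ge0 z_ge0 => z g_ge0 z_ge0.
have [j gj0] : exists j, g A x s j z alpha_opt = 0.
  apply: contrapT => /forallNP g_neq0; apply: (not_all_gt0 z) => // i.
  by rewrite lt0r g_ge0 andbT; apply/eqP.
have [Deltaj0|Deltaj_neq0] := eqVneq (Delta A x s j alpha_opt) 0.
  by constructor 3; exists j.
constructor 2; have [z0|z_neq0] := eqVneq z 0.
  by exists z; split=> //; exists j, j; split=> //; right.
exists z; split=> //; apply: contrapT => no_pair.
have [|i gi0|z' z'_ge0 /(not_all_gt0 _ z'_ge0)//] :=
  @g_gt0_perturb _ _ _ A x s alpha_opt z j _ g_ge0 _ gj0 Deltaj_neq0.
- by rewrite lt0r z_neq0.
- by apply: contrapT => i_neq_j; apply: no_pair; exists i, j; split=> //; left.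
Qed.
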